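(* There is a constant $k$ such that every (claw, $4K_1$, bridge, $C_4$-twin)-free graph $G$ that contains a $C_6$ (as an induced subgraph) has clique-width at most $k$.
   Context: All graphs are finite, simple and undirected. For a set $L$ of graphs, a graph $G$ is $L$-free if $G$ contains no graph of $L$ as an induced subgraph. $C_6$ is the chordless cycle on six vertices. The claw is $K_{1,3}$. $4K_1$ is the stable set on four vertices. The bridge is the six-vertex graph obtained from two disjoint copies of $K_4$ by identifying an edge of one with an edge of the other: its vertices are $u,v,a,b,c,d$, the sets $\{u,v,a,b\}$ and $\{u,v,c,d\}$ are cliques, and there are no edges between $\{a,b\}$ and $\{c,d\}$. The $C_4$-twin is the five-vertex graph on $\{1,2,3,4,5\}$ with edges $12,13,42,43,25,35,14$ (a chordless 4-cycle with one vertex duplicated by an adjacent twin). The clique-width of a graph is the smallest number of labels needed to construct it using the operations: create a new vertex with label $i$; take the disjoint union of two labelled graphs; relabel all vertices with label $i$ by label $j$; join every vertex labelled $i$ to every vertex labelled $j$ by an edge ($i\neq j$). *)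

(* Defs.v *)
From HB Require Import structures.
From mathcomp Require Import all_boot.
Set Implicit Arguments.
Unset Strict Implicit.
Unset Printing Implicit Defensive.

Record sgraph := SGraph {
  vertex :> finType;
  adj : rel vertex;
  adj_sym : symmetric adj;
  adj_irrefl : irreflexive adj
}.

Definition contains_induced (G H : sgraph) : Prop :=
  exists f : H -> G, injective f /\ forall x y, adj (f x) (f y) = adj x y.

Definition isomorphic (G H : sgraph) : Prop :=
  exists f : G -> H, bijective f /\ forall x y, adj (f x) (f y) = adj x y.

Definition L_free (L : sgraph -> Prop) (G : sgraph) : Prop :=
  forall H, L H -> ~ contains_induced G H.

Section GraphOfEdges.
Variables (n : nat) (E : seq (nat * nat)).

Definition edges_rel : rel 'I_n := fun x y =>
  (x != y) &&
  (((x : nat, y : nat) \in E) || ((y : nat, x : nat) \in E)).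

Lemma edges_rel_sym : symmetric edges_rel.
Proof. by move=> x y; rewrite /edges_rel eq_sym orbC. Qed.

Lemma edges_rel_irrefl : irreflexive edges_rel.
Proof. by move=> x; rewrite /edges_rel eqxx. Qed.

Definition graph_of_edges : sgraph :=
  SGraph edges_rel_sym edges_rel_irrefl.

End GraphOfEdges.

Definition C6 : sgraph :=
  graph_of_edges 6 [:: (0, 1); (1, 2); (2, 3); (3, 4); (4, 5); (5, 0)].

Definition claw : sgraph :=
  graph_of_edges 4 [:: (0, 1); (0, 2); (0, 3)].

Definition four_K1 : sgraph := graph_of_edges 4 [::].

(* u, v, a, b, c, d are 0, 1, 2, 3, 4, 5. *)
Definition bridge : sgraph :=
  graph_of_edges 6
    [:: (0, 1); (0, 2); (0, 3); (1, 2); (1, 3); (2, 3);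
        (0, 4); (0, 5); (1, 4); (1, 5); (4, 5)].

(* The 4-cycle 0, 1, 4, 2 together with 3, an adjacent twin of 0. *)
Definition C4_twin : sgraph :=
  graph_of_edges 5
    [:: (0, 1); (0, 2); (3, 1); (3, 2); (1, 4); (2, 4); (0, 3)].

Record lgraph (k : nat) := LGraph {
  lgraph_graph :> sgraph;
  label : lgraph_graph -> 'I_k
}.

Section Operations.
Variable k : nat.
Implicit Types (i j : 'I_k) (G H : lgraph k).

Definition vertex_graph : sgraph :=
  @SGraph unit (fun _ _ => false) (fun _ _ => erefl) (fun _ => erefl).

Definition lvertex i : lgraph k := @LGraph k vertex_graph (fun _ => i).

Definition union_rel (G H : sgraph) : rel (G + H)%type := fun x y =>
  match x, y with
  | inl x, inl y => adj x y
  | inr x, inr y => adj x y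
  | _, _ => false
  end.

Lemma union_rel_sym (G H : sgraph) : symmetric (@union_rel G H).
Proof. by move=> [x|x] [y|y] //=; apply: adj_sym. Qed.

Lemma union_rel_irrefl (G H : sgraph) : irreflexive (@union_rel G H).
Proof. by move=> [x|x] /=; apply: adj_irrefl. Qed.

Definition lunion G H : lgraph k :=
  @LGraph k (SGraph (@union_rel_sym G H) (@union_rel_irrefl G H))
    (fun x => match x with inl x => label x | inr x => label x end).

Definition lrelabel i j G : lgraph k :=
  @LGraph k G (fun x => if label x == i then j else label x).

Definition join_rel i j G : rel G := fun x y =>
  [|| adj x y,
      (label x == i) && (label y == j) |
      (label x == j) && (label y == i)].

Lemma join_rel_sym i j G : symmetric (@join_rel i j G).
Proof.
move=> x y; rewrite /join_rel adj_sym; congr (_ || _).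
by rewrite orbC [X in X || _]andbC [X in _ || X]andbC.
Qed.

Lemma join_rel_irrefl i j G : i != j -> irreflexive (@join_rel i j G).
Proof.
move=> /negbTE ij x; rewrite /join_rel adj_irrefl /=.
by case: eqP => [->|_]; rewrite ?ij ?andbF.
Qed.

Definition ljoin i j (ij : i != j) G : lgraph k :=
  @LGraph k (SGraph (@join_rel_sym i j G) (@join_rel_irrefl i j G ij))
    (@label k G).

Inductive cwexpr : Type :=
  | CwVertex of 'I_k
  | CwUnion of cwexpr & cwexpr
  | CwRelabel of 'I_k & 'I_k & cwexpr
  | CwJoin i j of i != j & cwexpr.

Fixpoint cweval (e : cwexpr) : lgraph k :=
  match e with
  | CwVertex i => lvertex i
  | CwUnion e1 e2 => lunion (cweval e1) (cweval e2)
  | CwRelabel i j e1 => lrelabel i j (cweval e1)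
  | CwJoin i j ij e1 => ljoin ij (cweval e1)
  end.

End Operations.

Definition constructible (k : nat) (G : sgraph) : Prop :=
  exists e : cwexpr k, isomorphic G (cweval e).

(* A relation and not a function: the graph without vertices has no
   construction, hence no clique-width. *)
Definition is_cliquewidth (G : sgraph) (w : nat) : Prop :=
  constructible w G /\ forall m, constructible m G -> w <= m.

(* Main.v *)
Require Import Defs.
From mathcomp Require Import all_boot.
From Stdlib Require Import Classical.
Set Implicit Arguments.
Unset Strict Implicit.
Unset Printing Implicit Defensive.

(** Fix an induced hexagon of G and sort the other vertices by their trace, the
    set of their neighbours on the hexagon.  There are at most 64 traces, and two
    facts about them are checked on finitely many small graphs: vertices with
    the same trace are adjacent ([same_trace_adj]), and two cliques of different
    traces never contain vertices x, x' and y, y' where x sees neither y nor y'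
    while x' sees both, a lopsided square ([no_lopsided_traces]).  So the vertices of
    G split into boundedly many cliques, and no two of them span such a square.

    Between two such cliques of at least four vertices, the absence of lopsided
    squares leaves two possibilities: the edges form a matching (sparse pair),
    or the non-edges do (dense pair).  Call these edges, resp. these
    non-edges, deviations.  Suppose that y deviates from x and from z, three
    vertices of three cliques, but x does not deviate from z.  A second
    deviation x'y' of the pair of cliques of x and y determines all adjacencies
    among x, x', y, y', z up to the three choices sparse or dense, and each of
    the eight cases contains a claw or a C_4-twin ([no_broken_triangle]).  Hence,
    outside a bounded set of exceptional vertices (the small cliques, and the
    ends of deviations between cliques that have at most two of them),
    deviation generates an equivalence relation whose blocks meet each clique at
    most once ([dev_trans], [dev_unique]).

    Such a graph has bounded clique-width ([constructible_of_blocks]): adjacency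
    between different blocks depends only on the cliques, so the blocks can be
    added one after the other, each vertex of the current block having a label
    of its own, and all earlier vertices sharing one label per clique.
    Exceptional vertices are blocks of their own, and the label of any
    other vertex records which of them it is adjacent to ([constructible_up_to_exceptions]). *)

(** * Building graphs block by block *)

Section Construction.
Variables (k : nat) (V : finType).
Implicit Types (S : {set V}) (A : rel V) (lab : V -> 'I_k).

(** Building a labelled graph inside a fixed vertex set [V] avoids the sum types
    produced by disjoint unions.  The empty graph has no expression, hence the
    first alternative, which makes induction start at the empty set. *)
Definition buildable S A lab : Prop :=
  S = set0 \/
  exists (e : cwexpr k) (f : cweval e -> V),
    [/\ injective f, forall v, v \in S <-> exists x, f x = v,
        forall x y, adj x y = A (f x) (f y) & forall x, label x = lab (f x)].

Lemma buildable_ext S S' A A' lab lab' :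
  buildable S A lab -> S =i S' ->
  {in S &, forall x y, A x y = A' x y} -> {in S, lab =1 lab'} ->
  buildable S' A' lab'.
Proof.
move=> + /setP <- eqA eqlab; case=> [->|[e [f [finj fS fA flab]]]]; [by left|right].
have inS x : f x \in S by apply/fS; exists x.
exists e, f; split=> // [x y|x]; first by rewrite fA eqA.
by rewrite flab eqlab.
Qed.

Lemma buildable_relabel S A lab i j :
  buildable S A lab ->
  buildable S A (fun v => if lab v == i then j else lab v).
Proof.
case=> [->|[e [f [finj fS fA flab]]]]; [by left|right].
by exists (CwRelabel i j e), f; split=> // x /=; rewrite flab.
Qed.

Lemma buildable_join S A lab i j :
  i != j -> buildable S A lab ->
  buildable S (fun x y => [|| A x y, (lab x == i) && (lab y == j)
                            | (lab x == j) && (lab y == i)]) lab.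
Proof.
move=> ij [->|[e [f [finj fS fA flab]]]]; [by left|right].
exists (CwJoin ij e), f; split=> // x y /=.
by rewrite /join_rel !flab -fA.
Qed.

Lemma buildable_joins S A lab j (l : seq 'I_k) :
  j \notin l -> buildable S A lab ->
  buildable S (fun x y => [|| A x y, (lab x \in l) && (lab y == j)
                            | (lab x == j) && (lab y \in l)]) lab.
Proof.
elim: l => [|i l IHl] /= jl bS.
  by apply: (buildable_ext bS) => // x y _ _; rewrite !in_nil andbF !orbF.
move: jl; rewrite in_cons negb_or eq_sym => /andP[ij jl].
apply: (buildable_ext (buildable_join ij (IHl jl bS))) => // x y _ _.
rewrite !in_cons; case: (A x y) => //=.
by do ![case: (_ == _) | case: (_ \in _)].
Qed.

Lemma buildable_isolated S A lab v :
  v \notin S -> (forall x, A x v = false) -> (forall x, A v x = false) ->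
  buildable S A lab -> buildable (v |: S) A lab.
Proof.
move=> vS Axv Avx [S0|[e [f [finj fS fA flab]]]]; right.
  exists (CwVertex (lab v)), (fun _ => v); split=> [[] [] //|u|x y|//].
    rewrite S0 setU0 in_set1; split=> [/eqP->|[_ ->]]; [by exists tt|exact: eqxx].
  by rewrite Axv.
have fv x : f x != v by apply: contraNneq vS => <-; apply/fS; exists x.
exists (CwUnion e (CwVertex (lab v))).
exists (fun x => match x with inl x => f x | inr _ => v end); split.
- move=> [x|[]] [y|[]] //= => [/finj ->//|/eqP|/esym/eqP];
  by rewrite (negbTE (fv _)).
- move=> u; rewrite in_setU1; split=> [/orP[/eqP->|/fS[x <-]]|].
  + by exists (inr tt).
  + by exists (inl x).
  by case=> [[x|[]] <-]; apply/orP; [right; apply/fS; exists x|left].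
- by move=> [x|x] [y|y] /=; rewrite ?Axv ?Avx.
by move=> [x|[]] /=.
Qed.
End Construction.

(** A new vertex can be attached to all its neighbours by joins when its label is
    fresh and its adjacency to the old vertices depends on their labels only. *)
Lemma buildable_insert k (G : sgraph) (S : {set G}) (lab : G -> 'I_k) v :
  v \notin S -> {in S, forall u, lab u != lab v} ->
  {in S &, forall u u', lab u = lab u' -> adj u v = adj u' v} ->
  buildable S (@adj G) lab -> buildable (v |: S) (@adj G) lab.
Proof.
move=> vS fresh unif bS.
pose A0 (x y : G) := [&& adj x y, x != v & y != v].
have neqv : {in S, forall u, u != v} by move=> u uS; apply: contraNneq vS => <-.
have b0 : buildable S A0 lab.
  by apply: (buildable_ext bS) => // x y xS yS; rewrite /A0 !neqv ?andbT.
have {b0} b1 : buildable (v |: S) A0 lab.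
  by apply: buildable_isolated => // x; rewrite /A0 eqxx ?andbF.
pose l := [seq lab u | u <- enum S & adj u v].
have lP u : u \in S -> (lab u \in l) = adj u v.
  move=> uS; apply/mapP/idP => [[u']|uv]; last first.
    by exists u; rewrite // mem_filter uv mem_enum.
  by rewrite mem_filter mem_enum => /andP[u'v u'S] /(unif _ _ uS u'S) ->.
have vl : lab v \notin l.
  apply/mapP => -[u]; rewrite mem_filter mem_enum => /andP[_ uS] /esym/eqP.
  by rewrite (negbTE (fresh _ uS)).
apply: (buildable_ext (buildable_joins vl b1)) => // x y.
rewrite !in_setU1 /A0 => /orP[/eqP->|xS] /orP[/eqP->|yS].
- by rewrite adj_irrefl !eqxx (negbTE vl).
- by rewrite !eqxx andbF (negbTE vl) /= lP // adj_sym.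
- by rewrite !eqxx !andbF lP // andbT (negbTE vl) andbF orbF.
by rewrite !neqv // !(negbTE (fresh _ _)) // !andbT andbF !orbF.
Qed.

Section Blocks.
Variables (G : sgraph) (C B : finType) (col : G -> C) (b : G -> B).
Hypothesis col_inj : forall u v, b u = b v -> col u = col v -> u = v.
Hypothesis col_adj : forall u v u' v', b u != b v -> b u' != b v' ->
  col u = col u' -> col v = col v' -> adj u v = adj u' v'.

(* The boolean distinguishes the block under construction, selected by [P], from
   the finished ones. *)
Let k := #|{: bool * C}|.
Let lab (P : pred G) : G -> 'I_k := fun v => enum_rank (P v, col v).

Lemma buildable_close_block S P :
  buildable S (@adj G) (lab P) -> buildable S (@adj G) (lab pred0).
Proof.
move=> bS.
have b_l (l : seq C) :
    buildable S (@adj G) (lab (fun v => P v && (col v \notin l))).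
  elim: l => [|c l IHl].
    by apply: (buildable_ext bS) => // v _; rewrite /lab in_nil andbT.
  pose i : 'I_k := enum_rank (true, c); pose j : 'I_k := enum_rank (false, c).
  apply: (buildable_ext (buildable_relabel i j IHl)) => // v _.
  rewrite /lab (inj_eq enum_rank_inj) xpair_eqE in_cons negb_or eqb_id.
  have [cv|_] := eqVneq (col v) c; rewrite /= ?andbT ?andbF //.
  by rewrite /j cv; case: ifP => // ->.
apply: (buildable_ext (b_l (enum C))) => // v _.
by rewrite /lab mem_enum andbF.
Qed.

(** Within the current block labels are distinct, because colours are; towards
    finished blocks only the colour matters.  So [buildable_insert] applies to
    every vertex of the block. *)
Lemma buildable_blocks (bs : seq B) :
  uniq bs -> buildable [set v | b v \in bs] (@adj G) (lab pred0).
Proof.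
elim: bs => [_|beta bs IHbs /= /andP[beta_bs /IHbs bS]].
  by left; apply/setP => v; rewrite !inE.
set S := [set v | b v \in bs] in bS.
pose P : pred G := fun v => b v == beta.
have bP : buildable S (@adj G) (lab P).
  apply: (buildable_ext bS) => // v; rewrite inE /lab /P => vbs.
  by case: eqP beta_bs => // <-; rewrite vbs.
have bl (l : seq G) : {subset l <= P} -> buildable (S :|: [set v in l]) (@adj G) (lab P).
  elim: l => [_|v l IHl lP].
    by apply: (buildable_ext bP) => // v; rewrite !inE orbF.
  have {}/IHl bl : {subset l <= P} by move=> u ul; apply: lP; rewrite in_cons ul orbT.
  have vP : b v = beta by apply/eqP/lP/mem_head.
  case vS: (v \in S :|: [set v in l]).
    apply: (buildable_ext bl) => // u; rewrite !inE in vS *.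
    by case: eqP => [->|_]; rewrite ?vS ?orbT.
  have {}bl : buildable (v |: (S :|: [set v in l])) (@adj G) (lab P).
    apply: buildable_insert => //; first by rewrite vS.
      move=> u uS; apply/eqP => /enum_rank_inj[].
      rewrite /P vP eqxx => /eqP ub /col_inj uv.
      by rewrite -uv ?uS ?ub ?vP in vS.
    move=> u u' uS u'S /enum_rank_inj[]; rewrite /P => Puu' cuu'.
    have [ub|ub] := eqVneq (b u) beta.
      by congr adj; apply: col_inj => //; apply/esym/eqP; rewrite ub -Puu' ub.
    by apply: col_adj; rewrite ?vP // -Puu' // (negbTE ub).
  by apply: (buildable_ext bl) => // u; rewrite !inE orbCA.
apply: (@buildable_close_block _ P).
apply: (buildable_ext (bl (enum P) _)) => //; first by move=> v; rewrite mem_enum.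
by move=> v; rewrite !inE mem_enum orbC.
Qed.

Lemma constructible_of_blocks (v0 : G) : constructible k G.
Proof.
case: (buildable_blocks (enum_uniq B)) => [/setP/(_ v0)|[e [f [finj fS fA _]]]].
  by rewrite !inE mem_enum.
have fsurj v : exists x, f x == v.
  have /fS[x <-] : v \in [set v | b v \in enum B] by rewrite inE mem_enum.
  by exists x.
pose g v := xchoose (fsurj v).
have fg v : f (g v) = v by apply/eqP/(xchooseP (fsurj v)).
exists e, g; split; last by move=> x y; rewrite fA !fg.
by exists f => // x; apply: finj; rewrite fg.
Qed.
End Blocks.

(** * Finitely many exceptional vertices *)

Section Exceptions.
Variables (G : sgraph) (T B : finType) (t : G -> T) (b : G -> B).
Variables (F : {set G}) (N : nat).
Hypothesis F_small : #|F| <= N.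
Hypothesis t_inj : {in ~: F &, forall u v, b u = b v -> t u = t v -> u = v}.
Hypothesis t_adj : forall u v u' v',
  u \notin F -> v \notin F -> u' \notin F -> v' \notin F ->
  b u != b v -> b u' != b v' -> t u = t u' -> t v = t v' -> adj u v = adj u' v'.

Let rk (v : G) : 'I_N.+1 := inord (index v (enum F)).
(* The list is shorter than the index range; past its end the default [v] gives
   the harmless value [adj v v], that is, [false]. *)
Let trace (v : G) : {ffun 'I_N.+1 -> bool} :=
  [ffun i : 'I_N.+1 => adj v (nth v (enum F) i)].

Let rkK v : v \in F -> rk v = index v (enum F) :> nat.
Proof.
move=> vF; rewrite inordK // ltnS (leq_trans _ F_small) // cardE.
by rewrite index_size.
Qed.

Let rk_inj : {in F &, injective rk}.
Proof.
move=> u v uF vF /(congr1 val) /=; rewrite !rkK // => eq_uv.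
by rewrite -(@nth_index _ u u (enum F)) ?mem_enum // eq_uv nth_index ?mem_enum.
Qed.

Let traceE u v : v \in F -> trace u (rk v) = adj u v.
Proof. by move=> vF; rewrite ffunE rkK // nth_index ?mem_enum. Qed.

Let C := ('I_N.+1 + T * {ffun 'I_N.+1 -> bool})%type.

(** Give each vertex of F its own colour and block, and refine the colour of the
    other vertices by their adjacency to F: colours then determine adjacency
    between blocks again. *)
Lemma constructible_up_to_exceptions (v0 : G) :
  constructible #|{: bool * C}| G.
Proof.
pose col v : C := if v \in F then inl (rk v) else inr (t v, trace v).
pose blk v : (G + B)%type := if v \in F then inl v else inr (b v).
have colF u v : u \in F -> col u = col v -> u = v.
  rewrite /col => uF; rewrite uF; case: ifP => // vF [] /rk_inj; exact.
have colNF u v : u \notin F -> col u = col v ->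
    [/\ v \notin F, t u = t v & trace u = trace v].
  by rewrite /col => /negbTE ->; case: ifP => // _ [-> ->].
apply: (@constructible_of_blocks G C (G + B)%type col blk) v0.
  move=> u v; case uF: (u \in F); first by move=> _ /colF; apply.
  move=> + /colNF; rewrite uF => + [] // vF tuv _.
  by rewrite /blk uF (negbTE vF) => -[bE]; apply: t_inj; rewrite ?inE ?uF.
move=> u v u' v' buv bu'v' cu cv.
have [uF|uF] := boolP (u \in F).
  have uu' := colF _ _ uF cu; rewrite -{}uu' {u' cu} in bu'v' *.
  have [vF|vF] := boolP (v \in F); first by rewrite (colF _ _ vF cv).
  have [_ _ tr] := colNF _ _ vF cv.
  by rewrite adj_sym -traceE // tr traceE // adj_sym.
have [u'F tu tr] := colNF _ _ uF cu.
have [vF|vF] := boolP (v \in F).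
  by rewrite -(colF _ _ vF cv) -traceE // tr traceE.
have [v'F tv _] := colNF _ _ vF cv.
move: buv bu'v'; rewrite /blk (negbTE uF) (negbTE vF) (negbTE u'F) (negbTE v'F).
by move=> buv bu'v'; apply: t_adj.
Qed.
End Exceptions.

(** Descends from [k] as long as fewer labels suffice. *)
Lemma is_cliquewidth_of_constructible k G :
  constructible k G -> exists w, is_cliquewidth G w /\ w <= k.
Proof.
elim/ltn_ind: k => k IHk Gk.
have [[m [Gm mk]]|no] := classic (exists m, constructible m G /\ m < k).
  have [w [Gw wm]] := IHk m mk Gm.
  by exists w; split=> //; apply: leq_trans wm (ltnW mk).
exists k; split=> //; split=> // m Gm; rewrite leqNgt; apply/negP => mk.
by apply: no; exists m.
Qed.

(** * Traces on the hexagon, by exhaustive search *)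

Definition edge (es : seq (nat * nat)) : rel nat := fun i j =>
  (i != j) && (((i, j) \in es) || ((j, i) \in es)).

Lemma edge_sym es : symmetric (edge es).
Proof. by move=> i j; rewrite /edge eq_sym orbC. Qed.

Lemma contains_of_seq (G : sgraph) (v0 : G) n es (vs : seq G) :
  size vs = n -> uniq vs ->
  (forall i j, i < n -> j < n -> adj (nth v0 vs i) (nth v0 vs j) = edge es i j) ->
  contains_induced G (graph_of_edges n es).
Proof.
move=> sz Uvs E; exists (fun i : 'I_n => nth v0 vs i); split=> [i j /eqP|i j].
  by rewrite nth_uniq ?sz // => /eqP/val_inj.
exact: E.
Qed.

(** Adjacency is tabulated, and the search below branches with [if] instead of
    [&&] and [||], because call-by-value evaluation computes both arguments of
    those connectives and would explore the whole search tree. *)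
Definition table n (E : rel nat) : seq (seq bool) :=
  [seq [seq E i j | j <- iota 0 n] | i <- iota 0 n].

Lemma nth_table n E i j :
  i < n -> j < n -> nth false (nth [::] (table n E) i) j = E i j.
Proof.
by move=> i_n j_n; rewrite !(nth_map 0, nth_iota) ?size_map ?size_iota.
Qed.

Fixpoint some_below (n : nat) (p : pred nat) : bool :=
  if n is n'.+1 then if p n' then true else some_below n' p else false.

Lemma some_belowP n p : some_below n p -> exists2 i, i < n & p i.
Proof.
elim: n => //= n IHn; case: ifP => [pn _|_ /IHn[i i_n pi]]; first by exists n.
by exists i => //; apply: ltnW.
Qed.

Fixpoint fits (v : nat) (nbrs row : seq bool) (l : seq nat) : bool :=
  match row, l with
  | a :: row', w :: l' =>
    if (v == w) || (nth false nbrs w != a) then false else fits v nbrs row' l'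
  | _, _ => true
  end.

Lemma fitsP v nbrs row l j :
  size row = size l -> fits v nbrs row l -> j < size l ->
  v != nth 0 l j /\ nth false nbrs (nth 0 l j) = nth false row j.
Proof.
elim: row l j => [|a row IHrow] [|w l] //= j [szl].
case: ifPn => //; rewrite negb_or negbK => /andP[vw /eqP va] fl.
by case: j => [|j] //=; apply: IHrow.
Qed.

(** Depth-first search for a pattern, given by the rows below the diagonal of its
    adjacency matrix, in the graph with adjacency matrix [M].  The list [l] holds
    the images of the pattern vertices placed so far, the last one first. *)
Fixpoint embeds (M rows : seq (seq bool)) (l : seq nat) : bool :=
  if rows is row :: rows' then
    some_below (size M) (fun v =>
      if fits v (nth [::] M v) row l then embeds M rows' (v :: l) else false)
  else true.

Definition pattern_row es k := [seq edge es k (k - j.+1) | j <- iota 0 k].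

Section Embeds.
Variables (G : sgraph) (v0 : G) (vs : seq G) (E : rel nat) (es : seq (nat * nat)).
Let n := size vs.
Hypothesis vs_uniq : uniq vs.
Hypothesis vs_adj :
  forall i j, i < n -> j < n -> adj (nth v0 vs i) (nth v0 vs j) = E i j.

Let g (l : seq nat) i := nth v0 vs (nth 0 l i).
Let good l := [/\ uniq l, {in l, forall i, i < n} &
  forall i j, i < size l -> j < size l ->
    adj (g l i) (g l j) = edge es (size l - i.+1) (size l - j.+1)].

Let embeds_good h l : good l ->
  embeds (table n E) [seq pattern_row es k | k <- iota (size l) h] l ->
  exists2 l', size l' = size l + h & good l'.
Proof.
elim: h l => [|h IHh] l gl /=; first by exists l; rewrite ?addn0.
case/some_belowP=> v; rewrite size_map size_iota => vn.
case: ifP => // fit_v.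
have [Ul ln lH] := gl.
have szr : size (pattern_row es (size l)) = size l by rewrite size_map size_iota.
have {}fit_v j : j < size l ->
    v != nth 0 l j /\ adj (nth v0 vs v) (g l j) = edge es (size l) (size l - j.+1).
  move=> jl; have ljn : nth 0 l j < n by apply/ln/mem_nth.
  have [vj] := fitsP szr fit_v jl; rewrite nth_table // vs_adj // => ->.
  by rewrite (nth_map 0) ?size_iota // nth_iota.
case/(IHh (v :: l)) => [|l' szl' gl']; last by exists l'; rewrite // szl' addSnnS.
split.
- rewrite /= Ul andbT; apply/negP => /(nthP 0)[j /fit_v[+ _] vj].
  by rewrite vj eqxx.
- by move=> i; rewrite in_cons => /orP[/eqP->|/ln].
move=> [|i] [|j] //=; rewrite /g /= ?subSS ?subn0 ?ltnS.
- by rewrite adj_irrefl /edge eqxx.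
- by move=> _ /fit_v[].
- by move=> /fit_v[_ fi] _; rewrite adj_sym fi edge_sym.
exact: lH.
Qed.

Lemma contains_of_embeds h :
  embeds (table n E) [seq pattern_row es k | k <- iota 0 h] [::] ->
  contains_induced G (graph_of_edges h es).
Proof.
case/(@embeds_good h [::]) => // l szl [Ul ln lH].
apply: (@contains_of_seq _ v0 h es [seq nth v0 vs i | i <- rev l]).
- by rewrite size_map size_rev.
- rewrite map_inj_in_uniq ?rev_uniq // => i j; rewrite !mem_rev.
  by move=> /ln il /ln jl /eqP; rewrite nth_uniq // => /eqP.
move=> i j ih jh; rewrite !(nth_map 0) ?size_rev ?szl // !nth_rev ?szl //.
have sub k : k < h -> h - k.+1 < h by move=> kh; rewrite ltn_subrL (leq_ltn_trans _ kh).
by rewrite [LHS]lH ?szl ?sub // !subnSK // !subKn // ltnW.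
Qed.
End Embeds.

Definition hexagon_edges := [:: (0, 1); (1, 2); (2, 3); (3, 4); (4, 5); (5, 0)].

(** The hexagon 0, ..., 5 followed by vertices 6, 7, ... whose traces on it are
    listed in [ts] and which are adjacent among themselves according to [P]. *)
Definition config (ts : seq (seq bool)) (P : rel nat) : rel nat := fun i j =>
  if i < 6 then
    if j < 6 then edge hexagon_edges i j else nth false (nth [::] ts (j - 6)) i
  else if j < 6 then nth false (nth [::] ts (i - 6)) j else P (i - 6) (j - 6).

Definition forbidden : seq (nat * seq (nat * nat)) :=
  [:: (4, [:: (0, 1); (0, 2); (0, 3)]);
      (4, [::]);
      (5, [:: (0, 1); (0, 2); (3, 1); (3, 2); (1, 4); (2, 4); (0, 3)]);
      (6, [:: (0, 1); (0, 2); (0, 3); (1, 2); (1, 3); (2, 3);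
              (0, 4); (0, 5); (1, 4); (1, 5); (4, 5)])].

Definition forbidden_rows : seq (seq (seq bool)) :=
  [seq [seq pattern_row H.2 k | k <- iota 0 H.1] | H <- forbidden].

Definition bad_config ts P : bool :=
  let M := table (6 + size ts) (config ts P) in
  some_below 4 (fun i => embeds M (nth [::] forbidden_rows i) [::]).

Fixpoint masks n : seq (seq bool) :=
  if n is n'.+1 then flatten [seq [:: true :: m; false :: m] | m <- masks n']
  else [:: [::]].

Lemma mem_masks (s : seq bool) : s \in masks (size s).
Proof.
elim: s => //= a s IHs; apply/flatten_mapP; exists s => //.
by case: a; rewrite !inE eqxx ?orbT.
Qed.

Lemma tuple_in_masks n (s : n.-tuple bool) : tval s \in masks n.
Proof. by have := mem_masks s; rewrite size_tuple. Qed.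

Lemma same_trace_check :
  all (fun s => bad_config [:: s; s] (edge [::])) (masks 6).
Proof. by vm_compute. Qed.

(** The square x, x', y, y' = 0, 1, 2, 3 inside two cliques, where x' sees both
    y and y' and x sees neither. *)
Definition lopsided := edge [:: (0, 1); (2, 3); (1, 2); (1, 3)].

(** Filtering leaves 21 of the 64 masks and makes the quadratic check below
    cheap. *)
Definition traces := [seq s <- masks 6 | ~~ bad_config [:: s] (edge [::])].

Lemma lopsided_check :
  all (fun s => all (fun t => bad_config [:: s; s; t; t] lopsided)
    [seq t <- traces | t != s]) traces.
Proof. by vm_compute. Qed.

Section Hexagon.
Variables (G : sgraph) (c : C6 -> G).
Hypotheses (c_inj : injective c) (c_adj : forall x y, adj (c x) (c y) = adj x y).
Hypothesis G_free :
  L_free (fun H => [\/ H = claw, H = four_K1, H = bridge | H = C4_twin]) G.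

Definition trace6 (v : G) : 6.-tuple bool := [tuple adj v (c i) | i < 6].

(** Transfers the computations on [config] to G. *)
Lemma good_config (xs : seq G) (P : rel nat) :
  uniq xs -> {in xs, forall x i, c i != x} ->
  (forall i j, i < size xs -> j < size xs ->
     adj (nth (c ord0) xs i) (nth (c ord0) xs j) = P i j) ->
  ~~ bad_config [seq tval (trace6 x) | x <- xs] P.
Proof.
move=> Uxs cxs xsP; apply/negP => /some_belowP[a a4].
rewrite (nth_map (0, [::])) //; set H := nth _ _ _ => H_emb.
have H_in : H \in forbidden by rewrite mem_nth.
case: H H_in H_emb => h es H_in /= H_emb.
set v0 := c ord0 in xsP.
have szc : size (codom c) = 6 by rewrite size_codom card_ord.
have nthc i (i6 : i < 6) : nth v0 (codom c) i = c (Ordinal i6).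
  rewrite (nth_map ord0) ?size_enum_ord //; congr c; apply: val_inj.
  by rewrite /= nth_enum_ord.
have traceE i (i6 : i < 6) x : nth false (trace6 x) i = adj x (c (Ordinal i6)).
  by rewrite -(tnth_nth _ _ (Ordinal i6)) tnth_mktuple.
have : contains_induced G (graph_of_edges h es).
  apply: (@contains_of_embeds G v0 (codom c ++ xs)
            (config [seq tval (trace6 x) | x <- xs] P)).
  - rewrite cat_uniq Uxs andbT map_inj_uniq ?enum_uniq //=.
    apply/hasPn => x xxs; apply/codomP => -[i xi].
    by have := cxs x xxs i; rewrite xi eqxx.
  - move=> i j; rewrite size_cat szc !nth_cat szc /config => i_lt j_lt.
    have sub k : k < 6 + size xs -> k < 6 = false -> k - 6 < size xs.
      by move=> k_lt k6; rewrite ltn_subLR // leqNgt k6.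
    case: (ltnP i 6) => i6; case: (ltnP j 6) => j6.
    + by rewrite !nthc c_adj.
    + rewrite nthc (nth_map v0) ?ltn_subLR // traceE; exact: adj_sym.
    + rewrite nthc (nth_map v0) ?ltn_subLR // traceE; exact: erefl.
    + by apply: xsP; rewrite ltn_subLR.
  by rewrite size_cat szc; rewrite size_map in H_emb.
apply: G_free; move: H_in; rewrite !inE => /or4P[]/eqP[-> ->].
- by constructor 1.
- by constructor 2.
- by constructor 4.
by constructor 3.
Qed.

(** A nonadjacent pair would yield one of 64 graphs on eight vertices, all of which
    contain a forbidden graph. *)
Lemma same_trace_adj x y :
  (forall i, c i != x) -> (forall i, c i != y) -> trace6 x = trace6 y ->
  x != y -> adj x y.
Proof.
move=> cx cy txy xy; apply: contraT => nxy.
have /allP/(_ _ (tuple_in_masks (trace6 x))) := same_trace_check.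
apply: contraTT => _.
have := @good_config [:: x; y] (edge [::]).
rewrite -[map _ _]/[:: tval (trace6 x); tval (trace6 y)] -txy.
apply; rewrite /= ?inE ?xy //.
  by move=> u /[!inE] /orP[]/eqP->.
move=> [|[|i]] [|[|j]] //= _ _; rewrite ?adj_irrefl ?(negbTE nxy) //.
by rewrite adj_sym (negbTE nxy).
Qed.

(** A counterexample would yield one of 21 * 20 graphs on ten vertices, all of which
    contain a forbidden graph. *)
Lemma no_lopsided_traces x x' y y' :
  (forall i, [/\ c i != x, c i != x', c i != y & c i != y']) ->
  trace6 x = trace6 x' -> trace6 y = trace6 y' -> trace6 x != trace6 y ->
  ~~ adj x y -> ~~ adj x y' -> adj x' y -> adj x' y' -> y = y'.
Proof.
move=> cxy tx ty txy xy xy' x'y x'y'; apply: contraTeq isT => yy'.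
have xx' : x != x' by apply: contraNneq xy => ->.
have axx' : adj x x' by apply: same_trace_adj => // i; case: (cxy i).
have ayy' : adj y y' by apply: same_trace_adj => // i; case: (cxy i).
have tr u : (forall i, c i != u) -> tval (trace6 u) \in traces.
  move=> cu; rewrite mem_filter tuple_in_masks andbT.
  apply: (@good_config [:: u]) => //; first by move=> v /[!inE] /eqP->.
  by move=> [|i] [|j] //= _ _; rewrite adj_irrefl.
have cx i : c i != x by case: (cxy i).
have cy i : c i != y by case: (cxy i).
rewrite eq_sym -val_eqE in txy.
have /allP/(_ _ (tr x cx))/allP/(_ (trace6 y)) := lopsided_check.
rewrite mem_filter txy tr // => /(_ isT).
apply: contraTT => _.
have tyx : tval (trace6 x) != trace6 y by rewrite eq_sym.
have := @good_config [:: x; x'; y; y'] lopsided.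
rewrite -[map _ _]/[seq tval s | s <-
          [:: trace6 x; trace6 x'; trace6 y; trace6 y']] -tx -ty.
apply.
- have neq u v : trace6 u = trace6 x -> trace6 v = trace6 y -> u != v.
    by move=> tu tv; apply: contraNneq tyx => uv; rewrite -tu -tv uv.
  by rewrite /= !inE !negb_or xx' yy' !neq.
- by move=> u /[!inE] /or4P[]/eqP-> i; case: (cxy i).
by move=> [|[|[|[|i]]]] [|[|[|[|j]]]] //= _ _;
  rewrite ?adj_irrefl //; do ?[exact/negbTE | by [] | rewrite adj_sym].
Qed.
End Hexagon.

(** * Matchings between cliques *)

Definition at_most_one (V : finType) (X : {set V}) (p : pred V) :=
  {in X &, forall y y', p y -> p y' -> y = y'}.

Lemma pick_avoiding (V : finType) (X : {set V}) (p q : pred V) (l : seq V) :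
  at_most_one X p -> at_most_one X q -> (size l).+2 < #|X| ->
  exists y, [/\ y \in X, ~~ p y, ~~ q y & y \notin l].
Proof.
have one (r : pred V) : at_most_one X r ->
    exists l' : seq V, size l' <= 1 /\ {in X, forall y, r y -> y \in l'}.
  move=> rX; case: (pickP [pred y in X | r y]) => [y0 /andP[y0X ry0]|no].
    by exists [:: y0]; split=> // y yX ry; rewrite inE (rX y y0).
  by exists [::]; split=> // y yX ry; have := no y; rewrite /= yX ry.
move=> /one[lp [szp inp]] /one[lq [szq inq]] szX.
have : ~~ (X \subset lp ++ lq ++ l).
  apply: contraL szX => /subset_leq_card leX; rewrite -leqNgt (leq_trans leX) //.
  rewrite (leq_trans (card_size _)) // !size_cat addnA -[_.+2]add2n.
  by rewrite leq_add2r -[2]/(1 + 1) leq_add.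
case/subsetPn => y yX; rewrite !mem_cat !negb_or => /and3P[yp yq yl].
by exists y; split=> //; [apply: contra yp|apply: contra yq]; auto.
Qed.

Lemma card_bigcup_leq (I V : finType) (A : I -> {set V}) n :
  (forall i, #|A i| <= n) -> #|\bigcup_i A i| <= #|I| * n.
Proof.
move=> An; apply: (@leq_trans (\sum_(i : I) #|A i|)).
  elim/big_rec2: _ => [|i m B _ IH]; first by rewrite cards0.
  by rewrite (leq_trans (leq_card_setU _ _)) // leq_add2l.
by rewrite -sum_nat_const leq_sum.
Qed.

Section Classes.
Variables (G : sgraph) (T : finType) (t : G -> T).
Hypothesis claw_free : ~ contains_induced G claw.
Hypothesis twin_free : ~ contains_induced G C4_twin.
Hypothesis class_clique : forall x y, t x = t y -> x != y -> adj x y.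
Hypothesis no_lopsided : forall x x' y y',
  t x = t x' -> t y = t y' -> t x != t y ->
  ~~ adj x y -> ~~ adj x y' -> adj x' y -> adj x' y' -> y = y'.
Implicit Types (x y z : G) (i j : T).

Lemma adj_neq (u v : G) : adj u v -> u != v.
Proof. by apply: contraTneq => ->; rewrite adj_irrefl. Qed.

Lemma no_claw (v a b c : G) : a != b -> a != c -> b != c ->
  adj v a -> adj v b -> adj v c -> ~~ adj a b -> ~~ adj a c -> ~~ adj b c -> False.
Proof.
move=> Nab Nac Nbc va vb vc ab ac bc; apply: claw_free.
apply: (@contains_of_seq G v 4 _ [:: v; a; b; c]) => //.
  by rewrite /= !inE !negb_or Nab Nac Nbc !adj_neq.
by move=> [|[|[|[|i]]]] [|[|[|[|j]]]] //= _ _;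
  rewrite ?adj_irrefl //; do ?[exact/negbTE | by [] | rewrite adj_sym].
Qed.

Lemma no_C4_twin (a b c a' d : G) : b != c ->
  adj a a' -> adj a b -> adj a c -> adj a' b -> adj a' c -> adj b d -> adj c d ->
  ~~ adj b c -> ~~ adj a d -> ~~ adj a' d -> False.
Proof.
move=> Nbc aa' ab ac a'b a'c bd cd bc ad a'd; apply: twin_free.
have Nad : a != d by apply: contraNneq a'd => <-; rewrite adj_sym.
have Na'd : a' != d by apply: contraNneq ad => <-.
apply: (@contains_of_seq G a 5 _ [:: a; b; c; a'; d]) => //.
  by rewrite /= !inE !negb_or Nad Na'd Nbc !adj_neq // adj_sym.
by move=> [|[|[|[|[|i]]]]] [|[|[|[|[|j]]]]] //= _ _;
  rewrite ?adj_irrefl //; do ?[exact/negbTE | by [] | rewrite adj_sym].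
Qed.

Local Ltac settle :=
  first [assumption | by apply/negbT | by rewrite eq_sym
        | by rewrite adj_sym | by rewrite adj_sym; apply/negbT].

(** The configuration behind transitivity: x, x' and y, y' come from two cliques
    and xy, x'y' are both deviations, so that the square xx'yy' is determined by
    the adjacency of x and y; z deviates from y, hence not from y', and from
    neither x nor x'.  The three free adjacencies xy, yz, xz give eight graphs,
    four with a claw and four with a C_4-twin. *)
Lemma no_broken_triangle (x x' y y' z : G) :
  uniq [:: x; x'; y; y'; z] -> adj x x' -> adj y y' ->
  adj x' y' = adj x y -> adj x y' = ~~ adj x y -> adj x' y = ~~ adj x y ->
  adj y' z = ~~ adj y z -> adj x' z = adj x z -> False.
Proof.
move=> U xx' yy' x'y' xy' x'y y'z x'z.
have [Nxy Nxy' Nxz] : [/\ x != y, x != y' & x != z].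
  by move: U; rewrite /= !inE !negb_or; case/and5P=> /and4P[].
have [Nx'y Nx'y' Nx'z] : [/\ x' != y, x' != y' & x' != z].
  by move: U; rewrite /= !inE !negb_or; case/and5P=> _ /and3P[].
have [Nyz Ny'z] : y != z /\ y' != z.
  by move: U; rewrite /= !inE !negb_or; case/and5P=> _ _ /andP[] _ ? ? _.
case xy: (adj x y) in x'y' xy' x'y; case yz: (adj y z) in y'z;
  case xz: (adj x z) in x'z; move: xy yz xz => xy yz xz.
- by apply: (@no_C4_twin x y x' z y'); settle.
- by apply: (@no_claw y x z y'); settle.
- by apply: (@no_C4_twin x' x y' z y); settle.
- by apply: (@no_claw y' x' y z); settle.
- by apply: (@no_C4_twin x' x y z y'); settle.
- by apply: (@no_claw y x' y' z); settle.
- by apply: (@no_C4_twin x x' y' z y); settle.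
- by apply: (@no_claw y' x y z); settle.
Qed.

Definition class i : {set G} := [set x | t x == i].

(** Among four vertices, two remain after discarding one exception for each of two
    vertices of another class. *)
Definition big i := 3 < #|class i|.

Lemma in_class i x : (x \in class i) = (t x == i).
Proof. by rewrite inE. Qed.

Lemma no_lopsided_col x x' y y' :
  t x = t x' -> t y = t y' -> t x != t y ->
  ~~ adj x y -> ~~ adj x' y -> adj x y' -> adj x' y' -> x = x'.
Proof.
move=> tx ty txy xy x'y xy' x'y'.
by apply: (@no_lopsided y y'); rewrite // 1?eq_sym // adj_sym.
Qed.

Lemma pick_class i (p q : pred G) (l : seq G) :
  big i -> at_most_one (class i) p -> at_most_one (class i) q -> size l <= 1 ->
  exists y, [/\ t y = i, ~~ p y, ~~ q y & y \notin l].
Proof.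
move=> bi p1 q1 szl; have [|y [+ py qy yl]] := @pick_avoiding _ (class i) p q l p1 q1.
  by apply: leq_ltn_trans bi.
by rewrite in_class => /eqP ty; exists y.
Qed.

Lemma other_in_class i x : big i -> exists x', t x' = i /\ x' != x.
Proof.
have none : at_most_one (class i) pred0 by [].
move=> bi; have [x' [tx' _ _]] := @pick_class i _ _ [:: x] bi none none isT.
by rewrite inE; exists x'.
Qed.

(** If x saw y1, y2 and missed two other vertices of class [j], then a second
    vertex x' of the class of x would see one of y1, y2 and miss one of the other
    two, as the squares on x, x' are not lopsided; these two vertices would form
    with x and x' a lopsided square in the other direction. *)
Lemma no_split x y1 y2 y3 y4 j : big (t x) -> t x != j ->
  t y1 = j -> t y2 = j -> t y3 = j -> t y4 = j ->
  adj x y1 -> adj x y2 -> y1 != y2 -> ~~ adj x y3 -> ~~ adj x y4 -> y3 = y4.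
Proof.
move=> bx txj t1 t2 t3 t4 x1 x2 y12 x3 x4.
have [x' [tx' x'x]] := other_in_class x bx.
have [a [ta xa x'a]] : exists a, [/\ t a = j, adj x a & adj x' a].
  case x'1: (adj x' y1); first by exists y1.
  case x'2: (adj x' y2); first by exists y2.
  case/eqP: y12; apply: (@no_lopsided x' x); by rewrite ?tx' ?t1 ?t2 ?x'1 ?x'2.
apply/eqP/contraT => y34.
have [b [tb xb x'b]] : exists b, [/\ t b = j, ~~ adj x b & ~~ adj x' b].
  case x'3: (adj x' y3); last by exists y3; rewrite x'3.
  case x'4: (adj x' y4); last by exists y4; rewrite x'4.
  by case/eqP: y34; apply: (@no_lopsided x x'); rewrite ?tx' ?t3 ?t4.
by case/eqP: x'x; apply: (@no_lopsided_col x' x b a); rewrite ?tx' ?tb ?ta.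
Qed.

(** By [no_split], either every vertex of class [i] has at most one neighbour in
    class [j], or some vertex with two neighbours misses at most one vertex. *)
Definition dense i j := [exists x, exists y, exists y',
  [&& t x == i, t y == j, t y' == j, y != y', adj x y & adj x y']].

Lemma denseP i j : reflect (exists x y y',
  [/\ t x = i, t y = j, t y' = j, y != y' & adj x y /\ adj x y']) (dense i j).
Proof.
apply: (iffP existsP) => [[x /existsP[y /existsP[y']]]|[x [y [y' []]]]].
  by case/and5P=> /eqP tx /eqP ty /eqP ty' yy' /andP[xy xy']; exists x, y, y'.
move=> tx ty ty' yy' [xy xy']; exists x; apply/existsP; exists y; apply/existsP.
by exists y'; rewrite tx ty ty' !eqxx yy' xy xy'.
Qed.

(** If x0 misses at most one vertex of class [j] but x misses two, then x sees at
    most one, and two of the four vertices of the class are seen by x0 and not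
    by x: a lopsided square. *)
Lemma dense_row x j : big (t x) -> big j -> t x != j -> dense (t x) j ->
  at_most_one (class j) (fun y => ~~ adj x y).
Proof.
move=> bx bj txj /denseP[x0 [y1 [y2 [tx0 t1 t2 y12 [x01 x02]]]]] y y'.
rewrite !in_class => /eqP ty /eqP ty' xy xy'; apply/eqP/contraT => yy'.
have p1 : at_most_one (class j) (adj x).
  move=> u v; rewrite !in_class => /eqP tu /eqP tv xu xv.
  apply/eqP/contraT => uv; rewrite -(negbTE yy').
  by apply/eqP/(@no_split x u v y y' j).
have p2 : at_most_one (class j) (fun u => ~~ adj x0 u).
  move=> u v; rewrite !in_class => /eqP tu /eqP tv x0u x0v.
  by apply: (@no_split x0 y1 y2 u v j); rewrite ?tx0.
have [a [ta xa x0a _]] := @pick_class _ _ _ [::] bj p1 p2 isT.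
have [b [tb xb x0b]] := @pick_class _ _ _ [:: a] bj p1 p2 isT.
rewrite inE => ba; rewrite negbK in x0a; rewrite negbK in x0b.
by case/eqP: ba; apply: (@no_lopsided x x0); rewrite ?tx0 ?ta ?tb.
Qed.

(** Two vertices of class [i] miss at most one vertex each, so they have a common
    neighbour among the four vertices of class [j]. *)
Lemma dense_symW i j : big i -> big j -> i != j -> dense i j -> dense j i.
Proof.
move=> bi bj ij dij; have /denseP[x1 [_ [_ [t1 _ _ _ _]]]] := dij.
have [x2 [t2 x21]] := other_in_class x1 bi.
have row x : t x = i -> at_most_one (class j) (fun y => ~~ adj x y).
  by move=> tx; apply: dense_row; rewrite ?tx.
have [d1 d2] := (row x1 t1, row x2 t2).
have [y [ty]] := @pick_class _ _ _ [::] bj d1 d2 isT.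
rewrite !negbK => x1y x2y _.
by apply/denseP; exists y, x2, x1; rewrite ![adj y _]adj_sym.
Qed.

Lemma dense_sym i j : big i -> big j -> i != j -> dense i j = dense j i.
Proof.
by move=> bi bj ij; apply/idP/idP; apply: dense_symW; rewrite // eq_sym.
Qed.

(** The edges of a sparse pair of classes and the non-edges of a dense one. *)
Definition dev x y := (t x != t y) && (adj x y != dense (t x) (t y)).

Lemma dev_sym x y : big (t x) -> big (t y) -> dev x y = dev y x.
Proof.
move=> bx by_; rewrite /dev [t y == _]eq_sym adj_sym.
by case: eqP => //= /eqP txy; rewrite dense_sym.
Qed.

Lemma dev_unique x j : big (t x) -> big j -> at_most_one (class j) (dev x).
Proof.
move=> bx bj y y'; rewrite !in_class => /eqP ty /eqP ty'.
rewrite /dev ty ty' => /andP[txj xy] /andP[_ xy'].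
case d: (dense (t x) j) xy xy'; rewrite ?eqb_id ?eqbF_neg ?negbK => xy xy'.
  by apply: (dense_row bx bj txj d); rewrite ?in_class ?ty ?ty'.
apply/eqP/contraT => yy'; case/denseP: (negbT d).
by exists x, y, y'; split.
Qed.

Lemma adj_dev x y : dev x y -> adj x y = ~~ dense (t x) (t y).
Proof. by case/andP=> _; case: adj; case: dense. Qed.

Lemma adj_ndev x y : t x != t y -> ~~ dev x y -> adj x y = dense (t x) (t y).
Proof. by rewrite /dev => -> /=; rewrite negbK => /eqP. Qed.

(** The ends in class [i] of the deviations towards class [j]; as deviations form
    a matching, their number is the number of deviations. *)
Definition devs i j : {set G} :=
  [set x | (t x == i) && [exists y, (t y == j) && dev x y]].
Definition rich i j := 2 < #|devs i j|.

(** Three deviations suffice: one is xy itself, and z deviates from at most one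
    vertex of the class of x. *)
Lemma second_dev x y z : big (t x) -> big (t y) -> big (t z) ->
  rich (t x) (t y) -> dev x y ->
  exists x' y', [/\ t x' = t x, t y' = t y, x' != x, y' != y &
    [/\ dev x' y', ~~ dev x y', ~~ dev x' y & ~~ dev z x']].
Proof.
move=> bx by_ bz rxy xy.
have z1 : at_most_one (devs (t x) (t y)) (dev z).
  move=> u v; rewrite !inE => /andP[tu _] /andP[tv _].
  by apply: (dev_unique bz bx); rewrite in_class.
have x1 : at_most_one (devs (t x) (t y)) (pred1 x) by move=> u v _ _ /eqP-> /eqP->.
have [x' [+ zx' x'x _]] := @pick_avoiding _ _ _ _ [::] z1 x1 rxy.
rewrite inE => /andP[/eqP tx' /existsP[y' /andP[/eqP ty' x'y']]].
have x'y : ~~ dev x' y.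
  apply: contra x'x => x'y; apply/eqP; apply: (dev_unique by_ bx);
  by rewrite ?in_class ?tx' // dev_sym ?tx'.
have y'y : y' != y by apply: contraNneq x'y => <-.
exists x', y'; split=> //; split=> //; apply: contra y'y => xy'; apply/eqP.
by apply: (dev_unique bx by_); rewrite ?in_class ?ty'.
Qed.

(** Otherwise a second deviation between the classes of x and y would complete
    the configuration excluded by [no_broken_triangle]. *)
Lemma dev_trans x y z : big (t x) -> big (t y) -> big (t z) ->
  rich (t x) (t y) -> t x != t z -> dev x y -> dev y z -> dev x z.
Proof.
move=> bx by_ bz rxy txz xy yz; apply/negPn/negP => nxz.
have [x' [y' [tx' ty' x'x y'y [x'y' xy' x'y zx']]]] := second_dev bx by_ bz rxy xy.
have [txy tyz] : t x != t y /\ t y != t z by case/andP: xy; case/andP: yz.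
have y'z : ~~ dev y' z.
  rewrite dev_sym ?ty' //; apply: contra y'y => zy'; apply/eqP.
  by apply: (dev_unique bz by_); rewrite ?in_class ?ty' // dev_sym.
have neq u v : t u != t v -> u != v by apply: contraNneq => ->.
apply: (@no_broken_triangle x x' y y' z).
- by rewrite /= !inE !negb_or !(eq_sym x x') !(eq_sym y y') x'x y'y !neq ?tx' ?ty'.
- by apply: class_clique; rewrite 1?eq_sym.
- by apply: class_clique; rewrite 1?eq_sym.
- by rewrite !adj_dev // tx' ty'.
- by rewrite adj_ndev ?ty' // adj_dev ?negbK.
- by rewrite adj_ndev ?tx' // adj_dev ?negbK.
- by rewrite adj_ndev ?ty' // adj_dev ?negbK.
by rewrite !adj_ndev ?tx' // dev_sym ?tx'.
Qed.

(** The vertices at which [dev_trans] may fail. *)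
Definition exceptional : {set G} :=
  [set v | ~~ big (t v) || [exists j, (v \in devs (t v) j) && ~~ rich (t v) j]].

Lemma card_exceptional : #|exceptional| <= #|T| * (3 + #|T| * 2).
Proof.
pose small i := if big i then set0 else class i.
pose poor i j := if rich i j then set0 else devs i j.
apply: (@leq_trans #|\bigcup_i (small i :|: \bigcup_j poor i j)|).
  apply/subset_leq_card/subsetP => v; rewrite inE => v_exc.
  apply/bigcupP; exists (t v) => //; rewrite inE.
  case/orP: v_exc => [/negbTE nb|/existsP[j /andP[vj /negbTE nr]]].
    by rewrite /small nb in_class eqxx.
  by apply/orP; right; apply/bigcupP; exists j; rewrite // /poor nr.
apply: card_bigcup_leq => i; rewrite (leq_trans (leq_card_setU _ _)) // leq_add //.
  by rewrite /small; case: ifP => [_|/negbT]; rewrite ?cards0 // -leqNgt.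
apply: card_bigcup_leq => j; rewrite /poor.
by case: ifP => [_|/negbT]; rewrite ?cards0 // -leqNgt.
Qed.

(** Outside the exceptional set, being equal or deviating is an equivalence
    relation, by [dev_trans], and its classes are the blocks: vertices of
    different blocks do not deviate, so [dense] tells whether they are adjacent. *)
Lemma constructible_of_classes (v0 : G) :
  constructible
    #|{: bool * ('I_(#|T| * (3 + #|T| * 2)).+1 +
         T * {ffun 'I_(#|T| * (3 + #|T| * 2)).+1 -> bool})}| G.
Proof.
pose F := exceptional.
have bigNF v : v \notin F -> big (t v) by rewrite inE negb_or negbK => /andP[].
have richNF u v : u \notin F -> dev u v -> rich (t u) (t v).
  rewrite inE negb_or negbK => /andP[_ /existsPn/(_ (t v))] + uv.
  by rewrite negb_and negbK inE eqxx /=; case/orP=> // /existsPn/(_ v); rewrite eqxx uv.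
pose linked u v := (u == v) || dev u v.
pose block v := [set w in ~: F | linked v w].
have mem_block v : v \notin F -> v \in block v.
  by move=> vF; rewrite in_set in_setC vF /linked eqxx.
have linked_dev u v w : u \notin F -> v \notin F -> w \notin F -> dev u v ->
    linked u w -> linked v w.
  move=> uF vF wF uv; have vu : dev v u by rewrite dev_sym ?bigNF.
  case/orP=> [/eqP<-|uw]; apply/orP; first by right.
  have [tvw|tvw] := eqVneq (t v) (t w); [left|right].
    by apply/eqP/(dev_unique (bigNF u uF) (bigNF v vF)); rewrite ?in_class ?tvw.
  by apply: (@dev_trans v u w); rewrite ?bigNF ?richNF.
have block_eq u v : u \notin F -> v \notin F -> dev u v -> block u = block v.
  move=> uF vF uv; have vu : dev v u by rewrite dev_sym ?bigNF.
  apply/setP => w; rewrite [_ \in block u]in_set [_ \in block v]in_set in_setC.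
  case: (boolP (w \in F)) => //= wF.
  by apply/idP/idP; [apply: (linked_dev u v)|apply: (linked_dev v u)].
have block_linked u v : v \notin F -> block u = block v -> linked u v.
  by move=> vF uv; have := mem_block v vF; rewrite -uv in_set => /andP[].
apply: (@constructible_up_to_exceptions G T {set G} t block F _ card_exceptional _ _ v0).
  move=> u v _; rewrite in_setC => vF /(block_linked _ _ vF)/orP[/eqP //|].
  by case/andP=> + _ tuv; rewrite tuv eqxx.
move=> u v u' v' uF vF u'F v'F buv bu'v' tu tv.
have [tuv|tuv] := eqVneq (t u) (t v).
  have tu'v' : t u' = t v' by rewrite -tu -tv.
  have Nuv : u != v by apply: contraNneq buv => ->.
  have Nu'v' : u' != v' by apply: contraNneq bu'v' => ->.
  by rewrite !class_clique.
have tu'v' : t u' != t v' by rewrite -tu -tv.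
rewrite !adj_ndev ?tu ?tv //.
  by apply: contra bu'v' => ?; apply/eqP/block_eq.
by apply: contra buv => ?; apply/eqP/block_eq.
Qed.
End Classes.

(** * Bounded clique-width *)

Section Partition.
Variables (G : sgraph) (c : C6 -> G).
Hypotheses (c_inj : injective c) (c_adj : forall x y, adj (c x) (c y) = adj x y).
Hypothesis G_free :
  L_free (fun H => [\/ H = claw, H = four_K1, H = bridge | H = C4_twin]) G.

(** The second component makes each vertex of the hexagon a class of its own,
    so that the partition covers G. *)
Definition hexagon_class (v : G) : 6.-tuple bool * option 'I_6 :=
  (trace6 c v, [pick i | c i == v]).

Lemma off_hexagon x x' :
  hexagon_class x = hexagon_class x' -> x != x' ->
  [/\ forall i, c i != x, forall i, c i != x' & trace6 c x = trace6 c x'].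
Proof.
move=> tt'; have tr := congr1 fst tt'; move/(congr1 snd): tt' => /=.
case: pickP => [i /eqP <-|off]; case: pickP => //.
  by move=> j /eqP <- [->]; rewrite eqxx.
by move=> off' _ _; split=> // i; [rewrite off|rewrite off'].
Qed.

Lemma hexagon_class_clique x y :
  hexagon_class x = hexagon_class y -> x != y -> adj x y.
Proof.
move=> txy xy; have [cx cy tr] := off_hexagon txy xy.
exact: (same_trace_adj c_inj c_adj G_free).
Qed.

Lemma hexagon_class_no_lopsided x x' y y' :
  hexagon_class x = hexagon_class x' -> hexagon_class y = hexagon_class y' ->
  hexagon_class x != hexagon_class y ->
  ~~ adj x y -> ~~ adj x y' -> adj x' y -> adj x' y' -> y = y'.
Proof.
move=> tx ty txy xy xy' x'y x'y'; apply/eqP/contraT => yy'.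
have xx' : x != x' by apply: contraNneq xy => ->.
have [cx cx' trx] := off_hexagon tx xx'.
have [cy cy' try_] := off_hexagon ty yy'.
case/eqP: yy'; apply: (no_lopsided_traces c_inj c_adj G_free _ trx try_) => //.
apply: contra txy => /eqP tr; rewrite /hexagon_class tr.
have none z : (forall i, c i != z) -> [pick i | c i == z] = None.
  by move=> cz; case: pickP => // i; rewrite (negbTE (cz i)).
by rewrite !none.
Qed.
End Partition.

Theorem theorem6p23 :
  exists k : nat, forall G : sgraph,
    L_free (fun H => [\/ H = claw, H = four_K1, H = bridge | H = C4_twin]) G ->
    contains_induced G C6 ->
    exists w : nat, is_cliquewidth G w /\ w <= k.
Proof.
eexists => G G_free [c [c_inj c_adj]].
apply: is_cliquewidth_of_constructible.
apply: (constructible_of_classes _ _ (hexagon_class_clique c_inj c_adj G_free)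
         (hexagon_class_no_lopsided c_inj c_adj G_free) (c ord0)).
  by apply: G_free; constructor 1.
by apply: G_free; constructor 4.
Qed.
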